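(* Let $\beta \ge 2$ be an integer and suppose that $a \le b$ is a reversed sum-product pair for the base $\beta$. Then $a < \beta$.
   Context: A base-$\beta$ representation of a positive integer is canonical if it has no leading zero. A pair of positive integers $a \le b$ is a reversed sum-product pair for the base $\beta$ if the canonical base-$\beta$ representations of $a+b$ and $ab$ are the reverse of each other as digit strings (in particular they have the same number of digits). *)

(* Defs.v *)
From mathcomp Require Import all_boot.

Set Implicit Arguments.
Unset Strict Implicit.
Unset Printing Implicit Defensive.

(* Digit strings are sequences of naturals, most significant digit first. *)

Definition digits_value (beta : nat) (s : seq nat) : nat :=
  foldl (fun n d => n * beta + d) 0 s.

(* The default value 0 of [head] makes the last conjunct exclude the empty
   string too. *)
Definition canonical_repr (beta n : nat) (s : seq nat) : Prop :=
  [/\ all (fun d => d < beta) s, digits_value beta s = n & head 0 s != 0].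

(* For 2 <= beta a positive integer has exactly one canonical representation,
   so the witness s is the representation of a + b. *)
Definition reversed_sum_product_pair (beta a b : nat) : Prop :=
  [/\ 0 < a, a <= b &
      exists s : seq nat,
        canonical_repr beta (a + b) s /\ canonical_repr beta (a * b) (rev s)].

(* Main.v *)
(* Write B for the base and let a + b and a * b have k + 1 digits.  Neither the
   leading nor the last digit of a * b is 0, the last one being the leading
   digit of a + b; hence a <> B, and for B = 2 both a * b and a + b would be odd.
   If a > B >= 3, then (a - B - 1)(b - B - 1) >= 0 gives
   (B + 1)(a + b - B - 1) <= a * b < B ^ (k + 1), whence B ^ k < (B + 1) ^ 2 and
   so k <= 2.  For k <= 1, a * b >= B ^ 2 is too large; for k = 2 the same bound
   makes the digits of a + b equal to 1, 0, y, and then a * b = y B ^ 2 + 1 is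
   too small. *)
Require Import Defs.
From mathcomp Require Import all_boot zify.

Lemma digits_value_rcons beta s d :
  digits_value beta (rcons s d) = digits_value beta s * beta + d.
Proof. by rewrite /digits_value -cats1 foldl_cat. Qed.

Lemma digits_value_cons beta d s :
  digits_value beta (d :: s) = d * beta ^ size s + digits_value beta s.
Proof.
elim/last_ind: s d => [|s c IHs] d; first by rewrite /digits_value /= muln1 addn0.
by rewrite -rcons_cons !digits_value_rcons IHs size_rcons expnSr; lia.
Qed.

Lemma digits_value_lt beta s :
  all (fun d => d < beta) s -> digits_value beta s < beta ^ size s.
Proof.
elim: s => [|d s IHs] //= /andP[d_lt /IHs v_lt].
rewrite digits_value_cons expnS; nia.
Qed.

Lemma three_digit_contradiction beta a b p x y :
  2 < beta -> p < beta -> x < beta -> y < beta -> 0 < p ->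
  beta < a -> a <= b ->
  a + b = (p * beta + x) * beta + y -> a * b = (y * beta + x) * beta + p -> False.
Proof.
move=> beta_gt2 p_lt x_lt y_lt p_gt0 lt_a le_ab sumE prodE.
have bound : beta.+1 * (a + b) <= a * b + beta.+1 * beta.+1 by nia.
have prod_lt : a * b < beta * beta * beta by nia.
(* [bound] and [prod_lt] give (beta + 1)(a + b) < beta^3 + (beta + 1)^2, which is at most (beta +
   1)(beta^2 + beta). *)
have sum_lt : a + b < beta * beta + beta by nia.
have p1 : p = 1 by nia.
have x0 : x = 0 by nia.
(* Since [y <= beta - 1], [bound] would now force 2 beta^2 <= 2 beta + 3. *)
subst p x; nia.
Qed.

Theorem proposition3p2 (beta a b : nat) (hbeta : 2 <= beta)
  (hab : reversed_sum_product_pair beta a b) : a < beta.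
Proof.
case: hab => a_gt0 le_ab [s [[s_digits sumE head_s] [_ prodE head_rev]]].
rewrite ltnNge; apply/negP => le_beta_a.
case: s => [//|p s] in s_digits sumE head_s prodE head_rev *.
have prod_lt : a * b < beta ^ (size s).+1.
  by rewrite -prodE -[(size s).+1]/(size (p :: s)) -size_rev digits_value_lt // all_rev.
have sum_ge : beta ^ size s <= a + b.
  by rewrite -sumE digits_value_cons; move: head_s => /=; nia.
move: s_digits head_s => /= /andP[p_lt s_digits] p_neq0.
have prodE' := prodE; rewrite rev_cons digits_value_rcons in prodE'.
have lt_beta_a : beta < a.
  rewrite ltn_neqAle le_beta_a andbT; apply: contraNneq p_neq0 => beta_a.
  by rewrite -(modn_small p_lt) -(modnMDl (digits_value beta (rev s))) prodE' -beta_a modnMr.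
(* Base 2 needs parity: as 2^3 < 3^2, the size estimate used for larger bases would still allow four
   digits. *)
have [beta2|beta_gt2] : beta = 2 \/ 2 < beta by lia.
  case/lastP: s => [|s y] in s_digits sumE head_rev prod_lt sum_ge prodE prodE' *.
    by move: prod_lt; rewrite /= expn1; nia.
  rewrite -rcons_cons digits_value_rcons in sumE.
  move: s_digits head_rev; rewrite all_rcons -rcons_cons rev_rcons /=.
  move=> /andP[y_lt _] y_neq0.
  have p1 : p = 1 by lia.
  have y1 : y = 1 by lia.
  have odd_prod : odd (a * b) by rewrite -prodE' oddD oddM beta2 andbF p1.
  have odd_sum : odd (a + b) by rewrite -sumE oddD oddM beta2 andbF y1.
  by move: odd_prod odd_sum; rewrite oddM oddD; case: (odd a); case: (odd b).
have bound : beta.+1 * (a + b) <= a * b + beta.+1 * beta.+1 by nia.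
rewrite expnS in prod_lt.
case: s => [|x [|y [|z s]]] in s_digits sumE head_rev prod_lt sum_ge prodE prodE' *.
- by move: prod_lt; rewrite /= expn0; nia.
- by move: prod_lt; rewrite /= expn1; nia.
- move: s_digits => /= /and3P[x_lt y_lt _].
  rewrite -lt0n in p_neq0.
  exact: (@three_digit_contradiction beta a b p x y).
- have pow_ge : beta * beta * beta <= beta ^ size [:: x, y, z & s].
    by rewrite -mulnA -[beta * (beta * beta)]/(beta ^ 3) leq_exp2l //.
  (* Put [sum_ge] and [prod_lt] into [bound]: beta times the power cancels on both sides. *)
  have pow_lt : beta ^ size [:: x, y, z & s] < beta.+1 * beta.+1 by nia.
  nia.
Qed.
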